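(* Let $\vec G$ be an ordered digraph with underlying graph $G$ and edge set $E$. The active filtration of $\vec G$ is a connected filtration of $G$, and it is the unique filtration (hence also the unique connected filtration) $(F'_\varepsilon,\ldots,F'_0,F_c,F_0,\ldots,F_\iota)$ of $G$ such that the $\iota$ minors $\vec G(F_k)/F_{k-1}$, $1\le k\le\iota$, are bipolar w.r.t. $\min(F_k\setminus F_{k-1})$, and the $\varepsilon$ minors $\vec G(F'_{k-1})/F'_k$, $1\le k\le\varepsilon$, are cyclic-bipolar w.r.t. $\min(F'_{k-1}\setminus F'_k)$.
   Context: Graphs are finite, may have loops and multiple edges, and are connected unless they arise as minors (isolated vertices are ignored). For $F\subseteq E$, $G(F)$ is the restriction of $G$ to $F$ (deletion of $E\setminus F$) and $G/F$ is the contraction of $F$; similarly for digraphs. Cycles and cocycles (inclusion-minimal non-empty edge cuts) are edge subsets. An ordered (di)graph has a linearly ordered edge set; minors inherit the order. A cycle is directed if its edges are consistently oriented along it; a cocycle is directed if all its edges go from one side of the cut to the other. $\subset$ denotes strict inclusion. A digraph is bipolar w.r.t. an edge $p$ if it is acyclic with a unique source and a unique sink, which are the extremities of $p$ (equivalently: every edge is in a directed cocycle and every directed cocycle contains $p$); in particular a single isthmus $p$ is bipolar. It is cyclic-bipolar w.r.t. $p$ if every edge is in a directed cycle and every directed cycle contains $p$ (equivalently: it is a single loop $p$, or it has at least two edges and reversing $p$ gives a digraph bipolar w.r.t. $p$). A filtration of $G$ (or of $E$) is a sequence $(F'_\varepsilon,\ldots,F'_0,F_c,F_0,\ldots,F_\iota)$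 of subsets of $E$ ($\iota,\varepsilon\ge0$ arbitrary) with $\emptyset=F'_\varepsilon\subset\cdots\subset F'_0=F_c=F_0\subset\cdots\subset F_\iota=E$, such that $\min(F_k\setminus F_{k-1})$, $1\le k\le\iota$, is increasing with $k$ and $\min(F'_{k-1}\setminus F'_k)$, $1\le k\le\varepsilon$, is increasing with $k$. It is connected if for every $1\le k\le\iota$ the minor $G(F_k)/F_{k-1}$ is either loopless and 2-connected with at least two edges, or a single isthmus, and for every $1\le k\le\varepsilon$ the minor $G(F'_{k-1})/F'_k$ is either loopless and 2-connected with at least two edges, or a single loop. (2-connected means 2-vertex-connected; a loopless graph on two vertices with at least one edge counts as 2-connected.) For an ordered digraph $\vec G$ with dual-active edges (smallest edges of directed cocycles) $a_1<\cdots<a_\iota$ and active edges (smallest edges of directed cycles) $a'_1<\cdots<a'_\varepsilon$, the active filtration is $\emptyset=F'_\varepsilon\subset\cdots\subset F'_0=F_c=F_0\subset\cdots\subset F_\iota=E$, where $F_c$ is the union of all directed cycles, $F_k=E\setminus\bigcup\{D\text{ directed cocycle}:\min(D)\ge a_{k+1}\}$ for $0\le k\le\iota-1$, and $F'_k=\bigcup\{C\text{ directed cycle}:\min(C)\ge a'_{k+1}\}$ for $0\le k\le\varepsilon-1$. *)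

(* Defs.v *)
From HB Require Import structures.
From mathcomp Require Import all_boot all_order.

Set Implicit Arguments.
Unset Strict Implicit.
Unset Printing Implicit Defensive.

(* A digraph whose edges are labelled in [T]; loops and multiple edges are
   allowed. The values of [src] and [tgt] outside [edges] are irrelevant.
   The underlying graph is the same data with [src e] and [tgt e] exchangeable:
   the undirected notions below are invariant under this exchange.              *)
Record digraph (T : finType) := Digraph {
  vtype : finType;
  edges : {set T};
  src : T -> vtype;
  tgt : T -> vtype
}.

Unset Implicit Arguments.

Section Digraph.
Context {T : finType}.
Implicit Types (G : digraph T) (A B C D : {set T}) (e f p : T).

(* Isolated vertices are ignored. *)
Definition vertices G : {set vtype G} :=
  src G @: edges G :|: tgt G @: edges G.

Definition adj G A : rel (vtype G) := fun u v =>
  [exists e in edges G :&: A,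
    ((src G e == u) && (tgt G e == v)) || ((src G e == v) && (tgt G e == u))].

Definition connected_graph G : Prop :=
  {in vertices G &, forall u v, connect (adj G (edges G)) u v}.

Definition restrict G A : digraph T :=
  Digraph (edges G :&: A) (src G) (tgt G).

(* The vertices of [G / B] are the connected components of the spanning
   subgraph with edge set [B], as sets of vertices of [G].                      *)
Definition component G B (u : vtype G) : {set vtype G} :=
  [set v | connect (adj G B) u v].

Definition contract G B : digraph T :=
  Digraph (edges G :\: B)
          (fun e => component G B (src G e)) (fun e => component G B (tgt G e)).

Definition minor G A B : digraph T := contract (restrict G A) B.

Definition loopless G : Prop := {in edges G, forall e, src G e != tgt G e}.

Definition incident G (v : vtype G) : {set T} :=
  [set e in edges G | (src G e == v) || (tgt G e == v)].

(* In [G] minus [v], vertices that have become isolated do count. *)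
Definition two_connected G : Prop :=
  [/\ 1 < #|vertices G|, connected_graph G &
      {in vertices G, forall v,
        {in vertices G :\ v &, forall x y,
          connect (adj G (edges G :\: incident G v)) x y}}].

Definition single_isthmus G : Prop :=
  exists2 e, edges G = [set e] & src G e != tgt G e.

Definition single_loop G : Prop :=
  exists2 e, edges G = [set e] & src G e == tgt G e.

(* [s] lists the edges of [C] in the order in which they are traversed. *)
Definition directed_cycle G C : bool :=
  [&& C != set0, C \subset edges G &
    [exists s : #|C|.-tuple T,
      [&& perm_eq s (enum C), cycle [rel e f | tgt G e == src G f] s &
          uniq [seq src G e | e <- s]]]].

Definition cut G (X : {set vtype G}) : {set T} :=
  [set e in edges G | (src G e \in X) != (tgt G e \in X)].

Definition cocycle G D : bool :=
  minset [pred A | (A != set0) && [exists X, A == cut G X]] D.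

Definition directed_cocycle G D : bool :=
  cocycle G D &&
  [exists X, (D == cut G X) && [forall e in D, src G e \in X]].

Definition acyclic G : Prop := forall C, ~~ directed_cycle G C.

Definition sources G : {set vtype G} :=
  [set v in vertices G | [forall e in edges G, tgt G e != v]].

Definition sinks G : {set vtype G} :=
  [set v in vertices G | [forall e in edges G, src G e != v]].

Definition bipolar G p : Prop :=
  [/\ p \in edges G, acyclic G &
      exists u v, [/\ sources G = [set u], sinks G = [set v] &
                      [set u; v] = [set src G p; tgt G p]]].

Definition cyclic_bipolar G p : Prop :=
  [/\ p \in edges G,
      {in edges G, forall e, exists2 C, directed_cycle G C & e \in C} &
      forall C, directed_cycle G C -> p \in C].

End Digraph.

Section Filtration.
Context {disp : Order.disp_t} {T : finOrderType disp}.
Implicit Types (G : digraph T) (A : {set T}).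

Definition is_min A (m : T) : bool :=
  (m \in A) && [forall e in A, (m <= e)%O].

(* The sequence (F'_eps, ..., F'_0, F_c, F_0, ..., F_iota), where
   [down = [:: F'_0; ...; F'_eps]] and [up = [:: F_0; ...; F_iota]].            *)
Record set_chain : Type := SetChain {
  down : seq {set T};
  mid : {set T};
  up : seq {set T}
}.
Implicit Type Phi : set_chain.

Definition len_up Phi : nat := (size (up Phi)).-1.
Definition len_down Phi : nat := (size (down Phi)).-1.
Definition Fup Phi (k : nat) : {set T} := nth set0 (up Phi) k.
Definition Fdown Phi (k : nat) : {set T} := nth set0 (down Phi) k.

Record filtration G Phi : Prop := Filtration {
  up_nonempty : up Phi != [::];
  down_nonempty : down Phi != [::];
  up_first : Fup Phi 0 = mid Phi;
  down_first : Fdown Phi 0 = mid Phi;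
  up_last : Fup Phi (len_up Phi) = edges G;
  down_last : Fdown Phi (len_down Phi) = set0;
  up_proper : forall k, 1 <= k <= len_up Phi -> Fup Phi k.-1 \proper Fup Phi k;
  down_proper :
    forall k, 1 <= k <= len_down Phi -> Fdown Phi k \proper Fdown Phi k.-1;
  up_min : forall j k p q, 1 <= j -> j < k -> k <= len_up Phi ->
    is_min (Fup Phi j :\: Fup Phi j.-1) p ->
    is_min (Fup Phi k :\: Fup Phi k.-1) q -> (p < q)%O;
  down_min : forall j k p q, 1 <= j -> j < k -> k <= len_down Phi ->
    is_min (Fdown Phi j.-1 :\: Fdown Phi j) p ->
    is_min (Fdown Phi k.-1 :\: Fdown Phi k) q -> (p < q)%O
}.

Definition up_minor G Phi k : digraph T :=
  minor G (Fup Phi k) (Fup Phi k.-1).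

Definition down_minor G Phi k : digraph T :=
  minor G (Fdown Phi k.-1) (Fdown Phi k).

Definition two_connected_block G : Prop :=
  [/\ loopless G, two_connected G & 1 < #|edges G|].

Definition connected_filtration G Phi : Prop :=
  [/\ filtration G Phi,
      forall k, 1 <= k <= len_up Phi ->
        two_connected_block (up_minor G Phi k) \/
        single_isthmus (up_minor G Phi k) &
      forall k, 1 <= k <= len_down Phi ->
        two_connected_block (down_minor G Phi k) \/
        single_loop (down_minor G Phi k)].

Definition bipolar_minors G Phi : Prop :=
  (forall k, 1 <= k <= len_up Phi ->
     exists2 p, is_min (Fup Phi k :\: Fup Phi k.-1) p &
                bipolar (up_minor G Phi k) p) /\
  (forall k, 1 <= k <= len_down Phi ->
     exists2 p, is_min (Fdown Phi k.-1 :\: Fdown Phi k) p &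
                cyclic_bipolar (down_minor G Phi k) p).

Definition dual_active G : {set T} :=
  [set a | [exists D, directed_cocycle G D && is_min D a]].

Definition active G : {set T} :=
  [set a | [exists C, directed_cycle G C && is_min C a]].

Definition min_ge A (a : T) : bool := [exists m, is_min A m && (a <= m)%O].

(* [Order.enum] lists a set in increasing order, so that the k-th term of
   [up] (resp. [down]) is defined from a_(k+1) (resp. a'_(k+1)).
   That F_0 = F_c = F'_0 is not built in.                                       *)
Definition active_filtration G : set_chain := {|
  down := rcons [seq \bigcup_(C | directed_cycle G C && min_ge C a) C
                | a <- Order.enum (active G)] set0;
  mid := \bigcup_(C | directed_cycle G C) C;
  up := rcons [seq edges G :\: \bigcup_(D | directed_cocycle G D && min_ge D a) D
              | a <- Order.enum (dual_active G)] (edges G)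
|}.

End Filtration.

(* Main.v *)
Require Import Defs.
From HB Require Import structures.
From mathcomp Require Import all_boot all_order.

Set Implicit Arguments.
Unset Strict Implicit.
Unset Printing Implicit Defensive.

Import Order.TTheory.

(** Let [cyc G A B] be [B] together with the edges that lie on directed cycles of
    the minor [G(A)/B], that is, the edges of [A] whose head reaches their tail
    when edges of [A] are used forwards and edges of [B] also backwards.
    Contracting edges of directed cycles, or deleting edges of no directed cycle,
    does not change which other edges are on directed cycles ([cyc_contract],
    [cyc_restrict]). Hence [dicl A = cyc G E A] is a closure operator, and so is
    its dual [cocl A], the complement of the union of the directed cycles that
    avoid [A]; by [in_directed_cocycle], an instance of Minty's lemma, the
    complement of [dicl A] in [E] is the union of the directed cocycles that
    avoid [A].

    Let [B] be a subset of [A], and [p] an element of [A] but not of [B]. Being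
    bipolar with respect to [p] means that [G(A)/B] has no directed cycle and
    that contracting [p] puts every edge on a directed cycle ([bipolarP]). If
    [A] is closed for [dicl], this says that [B] is closed and that [p] and [B]
    generate [A] ([bipolar_minor_closedP]). Cyclic-bipolar minors are the same
    thing for [cocl] and complements ([cyclic_bipolar_minor_openP]). As [E] is
    closed for [dicl], and the complement of the empty set for [cocl], this
    applies all along a filtration; so a filtration with bipolar and
    cyclic-bipolar minors is a pair of chains of closed sets, each term being
    generated by the previous one and the least new element, these least
    elements being increasing ([filtration_chains], [chains_filtration]). The two
    chains meet in the union of all directed cycles, which is the closure of the
    empty set for [dicl] and the complement of that for [cocl].

    Such a chain exists and is unique for any closure operator on an ordered set
    ([greedy_chainP], [closure_chain_unique]): its least new elements have to be
    the elements that are not spanned by smaller ones, and the term before [a] is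
    the closure of the elements smaller than [a]. For [dicl] these elements are
    the dual-active edges and for [cocl] the active ones, and the two chains are
    those of the active filtration ([up_active], [down_active]).

    Finally, in a bipolar digraph each vertex lies on a directed path from the
    source to the sink, and removing a vertex cannot break both halves of the
    path; so bipolar and cyclic-bipolar digraphs with at least two edges are
    loopless and 2-connected ([bipolar_block], [cyclic_bipolar_block]). *)

(** * Connectivity in finite relations *)

Section Connect.
Context {V : finType}.
Implicit Types (r : rel V) (u v x y s t : V).

Lemma connect_preserves r (P : pred V) x y :
  (forall u v, r u v -> P u -> P v) -> connect r x y -> P x -> P y.
Proof.
move=> rP /connectP[p + ->]; elim: p x => [|z p IHp] x //= /andP[rxz pz] Px.
by apply: IHp pz (rP _ _ rxz Px).
Qed.

(** A walk that uses the extra arc [t -> s] can be cut at its first and last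
    passage through it, so one passage is enough. *)
Lemma connect_add_arc r s t x y :
  connect (fun u v => r u v || ((u == t) && (v == s))) x y ->
  connect r x y || (connect r x t && connect r s y).
Proof.
move=> cxy; pose P z := connect r x z || (connect r x t && connect r s z).
apply: (connect_preserves (P := P) _ cxy); last by rewrite /P connect0.
move=> u v; rewrite /P => /orP[/connect1 ruv | /andP[/eqP-> /eqP->]].
  case/orP=> [xu | /andP[-> su]]; first by rewrite (connect_trans xu ruv).
  by rewrite (connect_trans su ruv) orbT.
by rewrite connect0 andbT => /orP[->|/andP[-> _]]; rewrite orbT.
Qed.

Lemma connect_avoid r w x y :
  connect r x y ->
  connect (fun u v => [&& r u v, u != w & v != w]) x y
  || (connect r x w && connect r w y).
Proof.
move=> cxy; set r' := (X in connect X).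
pose P z := connect r' x z || (connect r x w && connect r w z).
apply: (connect_preserves (P := P) _ cxy); last by rewrite /P connect0.
have r'r : subrel (connect r') (connect r).
  by apply: connect_sub => u v /andP[/connect1].
move=> u v ruv; rewrite /P => /orP[xu | /andP[-> wu]]; last first.
  by rewrite (connect_trans wu (connect1 ruv)) orbT.
have [ew | nuw] := eqVneq u w.
  by rewrite -ew (r'r _ _ xu) (connect1 ruv) orbT.
have [ew | nvw] := eqVneq v w.
  by rewrite -ew connect0 (connect_trans (r'r _ _ xu) (connect1 ruv)) orbT.
by rewrite (connect_trans xu) // connect1 // /r' ruv nuw.
Qed.

(** Along an arc of an acyclic relation the set of reachable points shrinks
    strictly, so a point reachable from [x] with the fewest successors has no
    outgoing arc. *)
Lemma acyclic_rel_sink r x :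
  (forall u v, r u v -> ~~ connect r v u) ->
  exists2 w, connect r x w & forall v, ~~ r w v.
Proof.
move=> acyc.
have [w xw wmin] := arg_minnP (fun w => #|connect r w|) (connect0 r x).
exists w => // v; apply/negP => rwv.
have /wmin := connect_trans xw (connect1 rwv).
apply/negP; rewrite -ltnNge; apply: proper_card; apply/properP; split.
  by apply/subsetP => z; apply: connect_trans (connect1 rwv).
by exists w; [exact: connect0 | exact: acyc].
Qed.

Lemma connect_first r x y :
  connect r x y -> x = y \/ exists z, r x z.
Proof.
case/connectP=> -[|z q] /=; first by left.
by case/andP=> rxz _ _; right; exists z.
Qed.

Lemma connect_last r x y :
  connect r x y -> x = y \/ exists z, r z y.
Proof.
case/connectP=> q; case: (lastP q) => [_ ->|q' z]; first by left.
rewrite rcons_path last_rcons => /andP[_ rz] ->; right; by exists (last x q').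
Qed.

End Connect.

(** * Directed reachability with reversible edges *)

(** Edges of [A] are traversed forwards and edges of [B] backwards. With
    [B \subset A] the edges of [B] can be used both ways, which is what
    contracting them does; [step G A A] is undirected adjacency. *)
Definition step (T : finType) (G : digraph T) (A B : {set T}) : rel (vtype G) :=
  fun u v =>
  [exists e in edges G, [&& e \in A, src G e == u & tgt G e == v]
                     || [&& e \in B, tgt G e == u & src G e == v]].

Arguments step {T} G A B.

Notation reach G A B := (connect (step G A B)).

Section Reach.
Context {T : finType} (G : digraph T).
Implicit Types (A B C D : {set T}) (e f p : T) (u v : vtype G).

Lemma stepP A B u v :
  reflect (exists2 e, e \in edges G &
             [/\ e \in A, src G e = u & tgt G e = v] \/
             [/\ e \in B, tgt G e = u & src G e = v])
          (step G A B u v).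
Proof.
apply: (iffP exists_inP) => -[e eG H]; exists e => //.
  by case/orP: H => /and3P[? /eqP-> /eqP->]; [left | right].
by case: H => [[-> -> ->] | [-> -> ->]]; rewrite !eqxx ?orbT.
Qed.

Lemma reach_fwd A B e :
  e \in edges G -> e \in A -> reach G A B (src G e) (tgt G e).
Proof. by move=> eG eA; apply/connect1/stepP; exists e; [|left]. Qed.

Lemma reach_bwd A B e :
  e \in edges G -> e \in B -> reach G A B (tgt G e) (src G e).
Proof. by move=> eG eA; apply/connect1/stepP; exists e; [|right]. Qed.

Lemma reach_sub A B A' B' :
  (forall e, e \in edges G -> e \in A -> reach G A' B' (src G e) (tgt G e)) ->
  (forall e, e \in edges G -> e \in B -> reach G A' B' (tgt G e) (src G e)) ->
  subrel (reach G A B) (reach G A' B').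
Proof.
move=> HA HB; apply: connect_sub => u v /stepP[e eG [] [eX <- <-]];
  [exact: HA | exact: HB].
Qed.

Lemma reach_mono A B A' B' :
  A \subset A' -> B \subset B' -> subrel (reach G A B) (reach G A' B').
Proof.
move=> /subsetP sA /subsetP sB; apply: reach_sub => e eG eX.
  by rewrite reach_fwd ?sA.
by rewrite reach_bwd ?sB.
Qed.

(** For [B \subset A], the set [B] together with the edges that lie on a directed
    cycle of the minor [G(A)/B]. *)
Definition cyc A B : {set T} :=
  B :|: [set e in edges G :&: A | reach G A B (tgt G e) (src G e)].

Lemma cyc_sup A B : B \subset cyc A B.
Proof. exact: subsetUl. Qed.

Lemma cyc_sub A B : B \subset A -> cyc A B \subset A.
Proof.
move=> sBA; rewrite subUset sBA; apply/subsetP=> e.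
by rewrite !inE => /andP[/andP[]].
Qed.

Lemma cyc_mono A B A' B' :
  A \subset A' -> B \subset B' -> cyc A B \subset cyc A' B'.
Proof.
move=> sA sB; apply: setUSS => //; apply/subsetP=> e; rewrite !inE.
by case/andP=> /andP[-> /(subsetP sA)->] /(reach_mono sA sB).
Qed.

(** Contracting edges that lie on directed cycles creates no directed cycle
    through a new edge: such an edge [f] can be bypassed backwards by the rest
    of a cycle through [f]. *)
Lemma cyc_contract A B : cyc A (cyc A B) = cyc A B.
Proof.
apply/eqP; rewrite eqEsubset cyc_sup andbT subUset subxx.
apply/subsetP=> e; rewrite !inE => /andP[/andP[eG eA] cye]; rewrite eG eA /=.
apply/orP; right; apply: reach_sub cye => f fG; first exact: reach_fwd.
by rewrite !inE => /orP[/(reach_bwd A fG) | /andP[]].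
Qed.

(** Deleting edges that lie on no directed cycle destroys no directed cycle: every
    forward edge of a closed walk lies on a directed cycle. *)
Lemma cyc_restrict A B : B \subset A -> cyc (cyc A B) B = cyc A B.
Proof.
move=> sBA; apply/eqP; rewrite eqEsubset cyc_mono ?cyc_sub //=.
rewrite subUset cyc_sup; apply/subsetP=> e eA.
rewrite !inE; apply/orP; right; move: eA; rewrite inE => /andP[].
rewrite inE => /andP[eG eA] cye; rewrite eG eA cye orbT /=.
(* The vertices that cannot reach [src G e] are off every closed walk through
   [e]; the invariant is vacuous there. *)
pose P z := reach G A B (tgt G e) z && reach G (cyc A B) B (tgt G e) z ||
  ~~ (reach G A B z (src G e)).
suff: P (src G e) by rewrite /P connect0 orbF => /andP[].
apply: (connect_preserves (P := P) _ cye); last by rewrite /P !connect0.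
move=> u v suv /orP[/andP[tu ctu]|nu]; last first.
  apply/orP; right; apply: contra nu; exact: connect_trans (connect1 suv).
rewrite /P (connect_trans tu (connect1 suv)) /=.
case vs: (reach G A B v (src G e)); rewrite ?orbT //= orbF.
apply: connect_trans ctu _.
case/stepP: suv tu vs => f fG [] [fX <- <-] tu vs; last exact: reach_bwd.
apply: reach_fwd; rewrite // !inE fG fX.
by rewrite /= (connect_trans vs (connect_trans (reach_fwd _ eG eA) tu)) orbT.
Qed.

End Reach.

(** * Directed cycles and directed cocycles *)

Section Minty.
Context {T : finType} (G : digraph T).
Implicit Types (A B C D : {set T}) (e f p : T) (u v : vtype G).

Local Notation follow := [rel e f | tgt G e == src G f].

Lemma path_edges A u q :
  path (step G A set0) u q ->
  exists s, [/\ {subset s <= edges G :&: A}, map (src G) s = belast u q &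
    forall e f, tgt G e = u -> src G f = last u q -> path follow e (rcons s f)].
Proof.
elim: q u => [|v q IHq] u /=.
  by exists [::]; split=> // e f eu fu; rewrite /= eu fu eqxx.
case/andP=> /stepP[g gG [[gA gu gv]|[]]]; last by rewrite inE.
case/IHq=> s [sA ss sp]; exists (g :: s); split=> [f | | e f eu fl] /=.
- by rewrite inE => /predU1P[->|/sA //]; rewrite inE gG gA.
- by rewrite gu ss.
- by rewrite eu gu eqxx sp.
Qed.

Lemma edges_path A s e f :
  {subset s <= edges G :&: A} -> path follow e (rcons s f) ->
  reach G A set0 (tgt G e) (src G f).
Proof.
elim: s e => [|g s IHs] e sA /=; first by rewrite andbT => /eqP->.
have /setIP[gG gA]: g \in edges G :&: A by rewrite sA ?mem_head.
case/andP=> /eqP-> /IHs tf; apply: connect_trans (reach_fwd _ gG gA) (tf _).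
by move=> h hs; rewrite sA // inE hs orbT.
Qed.

(** A simple path from the head of [e] back to its tail closes up with [e] to a
    directed cycle. *)
Lemma in_directed_cycle A e :
  reflect (exists2 C, directed_cycle G C & (e \in C) && (C \subset A))
          (e \in cyc G A set0).
Proof.
rewrite inE in_set0 /= inE; apply: (iffP idP) => [|[C]].
  case/andP=> /setIP[eG eA] /connectP[q0 q0P].
  case/shortenP: q0P => q qP uq _ qlast.
  have [s [sA ss sp]] := path_edges qP.
  have srcs : map (src G) (e :: s) = src G e :: belast (tgt G e) q.
    by rewrite /= ss.
  have uniq_srcs : uniq (map (src G) (e :: s)).
    by rewrite srcs qlast /= -rcons_uniq -lastI.
  have us := map_uniq uniq_srcs.
  have sizeC : size (e :: s) == #|[set x in e :: s]|.
    by rewrite cardsE; apply/eqP/esym/card_uniqP.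
  have sub : {subset e :: s <= edges G :&: A}.
    by move=> f; rewrite inE => /predU1P[->|/sA //]; rewrite inE eG.
  exists [set x in e :: s]; last first.
    rewrite inE mem_head; apply/subsetP => f; rewrite inE => /sub.
    by case/setIP.
  apply/and3P; split.
  - by apply/set0Pn; exists e; rewrite inE mem_head.
  - by apply/subsetP => f; rewrite inE => /sub; case/setIP.
  apply/existsP; exists (Tuple sizeC); rewrite uniq_srcs andbT.
  apply/andP; split.
    by apply: uniq_perm => [||x]; rewrite ?enum_uniq ?mem_enum ?inE //.
  exact: sp.
case/and3P=> _ CG /existsP[s /and3P[ps cs _]] /andP[eC CA].
have sC x : (x \in tval s) = (x \in C) by rewrite (perm_mem ps) mem_enum.
have [i s' rs] := rot_to (etrans (sC e) eC).
have := cs; rewrite -(rot_cycle i) rs /= => ps'.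
rewrite inE (subsetP CG) ?(subsetP CA) //=; apply: edges_path ps'.
move=> f fs'; have fC : f \in C by rewrite -sC -(mem_rot i) rs inE fs' orbT.
by rewrite inE (subsetP CG) ?(subsetP CA).
Qed.

(** The dual half of Minty's lemma. If the head of [e] cannot reach its tail,
    let [X] be the set of vertices reachable from the head: every edge between
    [X] and its complement enters [X], and none is in [B]. The component [K] of
    the tail in the complement of [X] gives a directed cut within it. Both [K]
    and [X] are connected by edges outside that cut, so a cut inside it takes
    all of its edges or none: it is a cocycle. *)
Lemma in_directed_cocycle B e :
  reflect (exists2 D, directed_cocycle G D & (e \in D) && [disjoint D & B])
          (e \in edges G :\: cyc G (edges G) B).
Proof.
rewrite !inE andbb negb_or; apply: (iffP andP) => [[]|[D]]; last first.
  case/andP=> _ /existsP[X /andP[/eqP DX /forall_inP srcX]] /andP[eD disjDB].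
  have := eD; rewrite {1}DX inE (srcX e) // => /andP[eG].
  case: (boolP (tgt G e \in X)) => // tX _.
  rewrite (contraL _ eD) => [|eB]; last by rewrite (disjointFl disjDB).
  split=> //; rewrite eG /=; apply/negP=> te.
  suff: src G e \notin X by rewrite srcX.
  apply: (connect_preserves (P := [predC X])) te tX => u v /=.
  case/stepP=> f fG [] [fX <- <-] /= uX; apply/negP=> vX.
    have /srcX : f \in D by rewrite DX inE fG (negPf uX) vX.
    by rewrite (negPf uX).
  have : f \in D by rewrite DX inE fG (negPf uX) vX.
  by rewrite (disjointFl disjDB).
move=> /andP[eB te] eG; rewrite eG /= in te.
pose X := [set v | reach G (edges G) B (tgt G e) v].
pose off := [set f in edges G | (src G f \notin X) && (tgt G f \notin X)].
pose K := [set v | reach G off off (src G e) v].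
have KX v : v \in K -> v \notin X.
  rewrite inE => Kv; apply: (connect_preserves (P := [predC X])) Kv _ => /=.
    by move=> u w /stepP[f _ [] []]; rewrite !inE => /and3P[_ sX tX] _ <-.
  by rewrite inE.
have cutK f : f \in cut G K ->
    [/\ f \in edges G, src G f \in K & tgt G f \in X].
  rewrite inE => /andP[fG]; have [tX|tX] := boolP (tgt G f \in X).
    have [//|sK] := boolP (src G f \in K).
    by case: (boolP (_ \in K)) => // /KX; rewrite tX.
  have sX : src G f \notin X.
    apply: contra tX; rewrite !inE => /connect_trans-> //.
    exact: reach_fwd.
  have foff : f \in off by rewrite inE fG sX.
  suff -> : (src G f \in K) = (tgt G f \in K) by rewrite eqxx.
  by rewrite !inE; apply/idP/idP => /connect_trans-> //;
    [exact: reach_fwd | exact: reach_bwd].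
have cutKdir f :
    f \in edges G -> src G f \in K -> tgt G f \in X -> f \in cut G K.
  by move=> fG sK tX; rewrite inE fG sK; apply/eqP => /esym/KX; rewrite tX.
have eK : src G e \in K by rewrite inE connect0.
have teX : tgt G e \in X by rewrite inE connect0.
exists (cut G K); last first.
  rewrite cutKdir //=; apply/pred0P => f /=; apply/negbTE/andP => -[].
  case/cutK => fG /KX sX; rewrite inE => tX fB; case/negP: sX; rewrite inE.
  exact: connect_trans tX (reach_bwd _ fG fB).
apply/andP; split; last first.
  by apply/existsP; exists K; rewrite eqxx; apply/forall_inP=> f /cutK[].
apply/minsetP; split=> [|D /andP[/= D0 /existsP[Z /eqP DZ]] sDK].
  rewrite inE /=; apply/andP; split; last by apply/existsP; exists K.
  by apply/set0Pn; exists e; apply: cutKdir.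
have sameZ f : f \in edges G -> f \notin cut G K ->
    (src G f \in Z) = (tgt G f \in Z).
  move=> fG /(contra (subsetP sDK f)); rewrite DZ inE fG /= negbK.
  by move/eqP.
have ZK v : v \in K -> (v \in Z) = (src G e \in Z).
  rewrite inE => cv; apply/eqP.
  apply: (connect_preserves (P := fun v => (v \in Z) == _)) cv (eqxx _).
  move=> u w /stepP[f fG ff] /eqP <-.
  have : f \notin cut G K.
    by apply/negP => /cutK[_ _ tX]; case: ff => -[]; rewrite inE tX !andbF.
  by move/(sameZ f fG) => sZ; case: ff => -[_ <- <-]; rewrite sZ.
have ZX v : v \in X -> (v \in Z) = (tgt G e \in Z).
  rewrite inE => cv; pose P v := (v \in X) && ((v \in Z) == (tgt G e \in Z)).
  suff /andP[_ /eqP//] : P v.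
  apply: (connect_preserves (P := P)) cv _; last by rewrite /P teX eqxx.
  move=> u w suw; rewrite /P => /andP[uX /eqP <-].
  have wX : w \in X.
    by move: uX; rewrite !inE => /connect_trans; apply; apply: connect1.
  rewrite wX /=; case/stepP: suw => f fG ff.
  have : f \notin cut G K.
    by apply/negP => /cutK[_ /KX sX _]; case: ff uX wX => -[_ <- <-];
       rewrite (negPf sX).
  by move/(sameZ f fG) => sZ; case: ff => -[_ <- <-]; rewrite sZ.
apply/eqP; rewrite eqEsubset sDK; case/set0Pn: D0 => g gD.
apply/subsetP=> f /cutK[fG fK fX]; move: (gD) (subsetP sDK g gD); rewrite DZ.
rewrite inE => /andP[_ gZ] /cutK[_ gK gX].
by rewrite inE fG (ZK _ fK) -(ZK _ gK) (ZX _ fX) -(ZX _ gX).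
Qed.
End Minty.

(** * Reachability in minors *)

Section Minors.
Context {T : finType} (G : digraph T).
Implicit Types (A B C D : {set T}) (e f p : T) (u v : vtype G).

Lemma reach_sym B : symmetric (reach G B B).
Proof.
apply: sym_connect_sym => u v.
by apply/stepP/stepP => -[e eG [] [eB <- <-]]; exists e => //;
   [right | left | right | left].
Qed.

Lemma adj_step (H : digraph T) A : adj H A =2 step H A A.
Proof.
move=> u v; apply/exists_inP/stepP => -[e].
  rewrite inE => /andP[eG eA] /orP[] /andP[/eqP <- /eqP <-].
    by exists e => //; left.
  by exists e => //; right.
move=> eG ev; exists e; first by rewrite inE eG; case: ev => -[->].
by case: ev => -[_ -> ->]; rewrite !eqxx ?orbT.
Qed.

Lemma step_restrict A X Y :
  step (restrict G A) X Y =2 step G (A :&: X) (A :&: Y).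
Proof.
move=> u v; apply/stepP/stepP => /= -[e].
  rewrite inE => /andP[eG eA] ev; exists e => //.
  by rewrite !inE eA.
rewrite !inE => eG ev; exists e.
  by rewrite inE eG; case: ev => -[/andP[->]].
by case: ev => -[/andP[_ ->] <- <-]; [left | right].
Qed.

Lemma mem_component A B u v :
  B \subset A -> (v \in component (restrict G A) B u) = reach G B B u v.
Proof.
move=> sBA; rewrite inE; apply: eq_connect => {}u {}v.
by rewrite (@adj_step (restrict G A)) step_restrict (setIidPr sBA).
Qed.

Lemma component_eq A B u v : B \subset A ->
  (component (restrict G A) B u = component (restrict G A) B v)
  <-> reach G B B u v.
Proof.
move=> sBA; split=> [euv|cuv].
  by rewrite -(mem_component _ _ sBA) euv mem_component.
apply/setP=> w; rewrite !mem_component //.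
apply/idP/idP; last exact: connect_trans.
by apply: connect_trans; rewrite reach_sym.
Qed.

(** A walk between the components of [B] lifts to a walk of [G] that moves
    freely inside them, and every walk of [G] projects. *)
Lemma reach_minor A B X Y u v : B \subset A ->
  reach (minor G A B) X Y (component (restrict G A) B u)
                                   (component (restrict G A) B v)
  = reach G (A :&: X :|: B) (A :&: Y :|: B) u v.
Proof.
move=> sBA; set c := component _ B; set r := step G _ _.
have BBr : subrel (reach G B B) (connect r).
  by apply: reach_mono; exact: subsetUr.
apply/idP/idP => [cuv|].
  pose P (x : vtype (minor G A B)) := [forall w, (x == c w) ==> connect r u w].
  suff /forall_inP : P (c v) by apply.
  apply: (connect_preserves (P := P)) cuv _; last first.
    by apply/forall_inP => w /eqP/component_eq-/(_ sBA)/BBr.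
  move=> x y /stepP[e]; rewrite inE => /andP[eB /setIP[eG eA]] ev.
  move=> /forall_inP Px; apply/forall_inP => w /eqP yw.
  case: ev yw Px => [[eX <- <-] | [eY <- <-]] /component_eq-/(_ sBA)/BBr ew Px.
    apply: connect_trans (Px _ (eqxx _)) (connect_trans _ ew).
    by apply: reach_fwd; rewrite // !inE eX eA.
  apply: connect_trans (Px _ (eqxx _)) (connect_trans _ ew).
  by apply: reach_bwd; rewrite // !inE eY eA.
pose P w := reach (minor G A B) X Y (c u) (c w).
move=> cuv; apply: (connect_preserves (P := P)) cuv _; last exact: connect0.
move=> x y /stepP[e eG ev]; rewrite /P => /connect_trans-> //.
have [eB|eB] := boolP (e \in B).
  suff -> : c x = c y by exact: connect0.
  apply/component_eq => //.
  by case: ev => -[_ <- <-]; [exact: reach_fwd | exact: reach_bwd].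
case: ev => -[]; rewrite !inE (negPf eB) orbF => /andP[eA eX] <- <-.
  by apply: (@reach_fwd _ (minor G A B)) => //; rewrite !inE eB eG.
by apply: (@reach_bwd _ (minor G A B)) => //; rewrite !inE eB eG.
Qed.

Lemma edges_minor A B : edges (minor G A B) = edges G :&: (A :\: B).
Proof. by apply/setP=> e; rewrite !inE andbCA. Qed.

Lemma cyc_minor A B X Y e : B \subset A -> e \in edges (minor G A B) ->
  (e \in cyc (minor G A B) X Y)
  = (e \in cyc G (A :&: X :|: B) (A :&: Y :|: B)).
Proof.
move=> sBA; rewrite edges_minor !inE => /andP[eG /andP[eB eA]].
by rewrite reach_minor // eG eB eA (negPf eB) !orbF.
Qed.

End Minors.

(** * Bipolarity as a statement about closed walks *)

Section Bipolar.
Context {T : finType} (G : digraph T).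
Implicit Types (A B C D : {set T}) (e f p : T) (u v : vtype G).

Lemma acyclicP : acyclic G <-> cyc G setT set0 = set0.
Proof.
split=> [acG | cyc0 C].
  apply/setP => e; rewrite in_set0; apply/in_directed_cycle => -[C dC].
  by rewrite (negPf (acG C)) in dC.
apply/negP => dC; have /and3P[/set0Pn[e eC] _ _] := dC.
suff : e \in cyc G setT set0 by rewrite cyc0 inE.
by apply/in_directed_cycle; exists C; rewrite // eC subsetT.
Qed.

Lemma acyclic_step A : cyc G A set0 = set0 ->
  forall u v, step G A set0 u v -> ~~ reach G A set0 v u.
Proof.
move=> cyc0 u v /stepP[e eG [[eA <- <-]|[]]]; last by rewrite inE.
by apply/negP => te; move/setP/(_ e): cyc0; rewrite !inE eG eA te.
Qed.

Lemma reach_reversing p A x y : p \in edges G ->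
  reach G A [set p] x y ->
  reach G A set0 x y
  || (reach G A set0 x (tgt G p) && reach G A set0 (src G p) y).
Proof.
move=> pG cxy; apply: connect_add_arc; move: cxy.
apply: connect_sub => u v /stepP[e eG ev]; apply: connect1.
case: ev => -[]; last by rewrite inE => /eqP-> <- <-; rewrite !eqxx orbT.
by move=> eA <- <-; apply/orP; left; apply/stepP; exists e => //; left.
Qed.

Lemma bipolar_paths A p e : p \in edges G -> e \in edges G ->
  e \in cyc G A [set p] -> e \notin cyc G A set0 ->
  reach G A set0 (src G p) (src G e)
  /\ reach G A set0 (tgt G e) (tgt G p).
Proof.
move=> pG eG; rewrite !inE eG /=; case: eqVneq => [-> _ _|_ /=].
  by rewrite !connect0.
case/andP=> eA /(reach_reversing pG)/orP[te|/andP[-> ->] //].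
by rewrite eA te.
Qed.

Lemma vertexP v :
  reflect (exists2 e, e \in edges G & src G e = v \/ tgt G e = v)
          (v \in vertices G).
Proof.
rewrite inE; apply: (iffP orP) => [[]/imsetP[e eG ->]|[e eG [] <-]].
- by exists e; auto.
- by exists e; auto.
- by left; apply: imset_f.
- by right; apply: imset_f.
Qed.

Lemma step_vertex A B u v :
  step G A B u v -> (u \in vertices G) * (v \in vertices G).
Proof.
by case/stepP=> e eG [] [_ <- <-]; split; apply/vertexP; exists e; auto.
Qed.

Lemma reach_vertex A B u v : reach G A B u v ->
  u \in vertices G -> v \in vertices G.
Proof. by apply: connect_preserves => x y /step_vertex[]. Qed.

(** The last condition says that [p] lies in every directed cocycle: contracting
    [p] leaves none. If there is one source [s] and one sink [t], the head of
    any edge reaches [t], which leads back to [s] through [p] reversed, and [s]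
    reaches its tail. Conversely a closed walk through an edge at a source or a
    sink must use [p] reversed exactly there. *)
Lemma bipolarP p :
  bipolar G p <-> [/\ p \in edges G, cyc G setT set0 = set0
                   & edges G \subset cyc G setT [set p]].
Proof.
split.
  case=> pG /acyclicP cyc0 [s [t [Gs Gt st]]].
  have acyc := acyclic_step cyc0.
  have /setIdP[sV /forall_inP s_src] : s \in sources G by rewrite Gs set11.
  have /setIdP[tV /forall_inP t_snk] : t \in sinks G by rewrite Gt set11.
  have src_p : src G p = s.
    have : s \in [set src G p; tgt G p] by rewrite -st set21.
    by case/set2P => // sp; have := s_src p pG; rewrite sp eqxx.
  have tgt_p : tgt G p = t.
    have : t \in [set src G p; tgt G p] by rewrite -st set22.
    by case/set2P => // tp; have := t_snk p pG; rewrite tp eqxx.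
  split=> //; apply/subsetP=> e eG; rewrite !inE eG /=; apply/orP; right.
  have to_t : reach G setT set0 (tgt G e) t.
    have [w tw wP] := acyclic_rel_sink (tgt G e) acyc.
    have : w \in sinks G; last by rewrite Gt => /set1P <-.
    rewrite inE (reach_vertex tw); last by apply/vertexP; exists e; auto.
    apply/forall_inP => f fG; apply: contra (wP (tgt G f)) => /eqP fw.
    by apply/stepP; exists f => //; left.
  have from_s : reach G setT set0 s (src G e).
    have [|w] := @acyclic_rel_sink _ [rel u v | step G setT set0 v u] (src G e).
      by move=> u v /acyc; rewrite (connect_rev (step G setT set0)).
    rewrite connect_rev /= => ws wP.
    have : w \in sources G; last by rewrite Gs => /set1P <-.
    rewrite inE; apply/andP; split.
      have [->|[z /step_vertex[] //]] := connect_first ws.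
      by apply/vertexP; exists e; auto.
    apply/forall_inP => f fG; apply: contra (wP (src G f)) => /eqP fw.
    by apply/stepP; exists f => //; left.
  apply: connect_trans (reach_mono _ _ to_t) _; rewrite ?sub0set //.
  rewrite -tgt_p; apply: connect_trans (reach_bwd _ pG (set11 p)) _.
  by rewrite src_p; apply: (reach_mono _ _ from_s); rewrite ?sub0set.
case=> pG cyc0 cycp; have acyc := acyclic_step cyc0.
have from_to e : e \in edges G ->
    reach G setT set0 (src G p) (src G e)
    /\ reach G setT set0 (tgt G e) (tgt G p).
  move=> eG; apply: bipolar_paths => //; first exact: (subsetP cycp).
  by rewrite cyc0 inE.
have sT e : e \in edges G -> step G setT set0 (src G e) (tgt G e).
  by move=> eG; apply/stepP; exists e => //; left.
have s_src e : e \in edges G -> tgt G e != src G p.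
  move=> eG; apply/eqP => ts; have := acyc _ _ (sT e eG).
  by rewrite ts; case: (from_to e eG) => ->.
have t_snk e : e \in edges G -> src G e != tgt G p.
  move=> eG; apply/eqP => ts; have := acyc _ _ (sT e eG).
  by rewrite ts; case: (from_to e eG) => _ ->.
split=> //; first exact/acyclicP.
exists (src G p), (tgt G p); split=> //; apply/setP=> v;
  rewrite [LHS]in_set [RHS]in_set1.
- apply/andP/eqP => [[/vertexP[e eG [ev|ev]] /forall_inP v_src]|->].
  + have [sv _] := from_to e eG; move: sv.
    rewrite ev => /connect_last[//|[z /stepP[f fG [[_ _ fv]|[]]]]].
      by have := v_src f fG; rewrite fv eqxx.
    by rewrite inE.
  + by have := v_src e eG; rewrite ev eqxx.
  split; [by apply/vertexP; exists p; auto | exact/forall_inP].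
- apply/andP/eqP => [[/vertexP[e eG [ev|ev]] /forall_inP v_snk]|->].
  + by have := v_snk e eG; rewrite ev eqxx.
  + have [_ tv] := from_to e eG; move: tv.
    rewrite ev => /connect_first[//|[z /stepP[f fG [[_ fv _]|[]]]]].
      by have := v_snk f fG; rewrite fv eqxx.
    by rewrite inE.
  split; [by apply/vertexP; exists p; auto | exact/forall_inP].
Qed.

End Bipolar.

Section CyclicBipolar.
Context {T : finType} (G : digraph T).
Implicit Types (A B C D : {set T}) (e f p : T) (u v : vtype G).

Lemma cyclic_bipolarP p :
  cyclic_bipolar G p <-> [/\ p \in edges G, edges G \subset cyc G setT set0
                          & cyc G [set~ p] set0 = set0].
Proof.
split=> [[pG allC pC] | [pG allC pC]].
  split=> //.
    apply/subsetP => e /allC[C dC eC].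
    by apply/in_directed_cycle; exists C; rewrite // eC subsetT.
  apply/setP => e; rewrite in_set0.
  apply/in_directed_cycle => -[C dC /andP[_ /subsetP /(_ p (pC C dC))]].
  by rewrite !inE eqxx.
split=> // [e eG | C dC].
  have /in_directed_cycle[C dC /andP[eC _]] := subsetP allC e eG.
  by exists C.
apply/negPn/negP => pnC; have /and3P[/set0Pn[e eC] _ _] := dC.
suff : e \in cyc G [set~ p] set0 by rewrite pC inE.
apply/in_directed_cycle; exists C; rewrite // eC; apply/subsetP=> f fC.
by rewrite !inE; apply: contra pnC => /eqP <-.
Qed.

Lemma cyc_eq0P A :
  cyc G A set0 = set0 <-> {in edges G, forall e, e \notin cyc G A set0}.
Proof.
split=> [-> e _|H]; first by rewrite inE.
apply/setP=> e; rewrite in_set0; apply/negP => ce.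
have eG : e \in edges G by move: ce; rewrite !inE /= => /andP[/andP[]].
by move: ce; rewrite (negPf (H e eG)).
Qed.

End CyclicBipolar.

Section BipolarMinors.
Context {T : finType} (G : digraph T).
Implicit Types (A B C D : {set T}) (e f p : T) (u v : vtype G).

Lemma bipolar_minorP A B p : B \subset A -> A \subset edges G ->
  bipolar (minor G A B) p
  <-> [/\ p \in A :\: B, cyc G A B = B & cyc G A (p |: B) = A].
Proof.
move=> sBA sAG; have M : edges (minor G A B) = A :\: B.
  by rewrite edges_minor; apply/setIidPr/(subset_trans _ sAG)/subsetDl.
have M0 e : e \in A :\: B ->
    (e \in cyc (minor G A B) setT set0) = (e \in cyc G A B).
  move=> eM; rewrite cyc_minor ?M //.
  by rewrite setIT setI0 set0U (setUidPl sBA).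
have Mp e : p \in A -> e \in A :\: B ->
    (e \in cyc (minor G A B) setT [set p]) = (e \in cyc G A (p |: B)).
  move=> pA eM; rewrite cyc_minor ?M //.
  by rewrite setIT (setUidPl sBA) (setIidPr _) ?sub1set.
apply: iff_trans (bipolarP _ _) _; rewrite M.
split=> [[pM /cyc_eq0P acyc cycp]|[pM acyc cycp]]; have /setDP[pA pB] := pM;
  split=> //.
- apply/eqP; rewrite eqEsubset cyc_sup andbT; apply/subsetP=> e ce.
  apply/negPn/negP => eB; have eM : e \in A :\: B.
    by rewrite inE eB (subsetP (cyc_sub _ sBA) e ce).
  by have := acyc e; rewrite M M0 // ce => /(_ eM).
- have spA : p |: B \subset A by rewrite subUset sub1set pA.
  apply/eqP; rewrite eqEsubset cyc_sub //=; apply/subsetP=> e eA.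
  have [eB|eB] := boolP (e \in B).
    by rewrite (subsetP (cyc_sup _ _ _)) // inE eB orbT.
  have eM : e \in A :\: B by rewrite inE eB.
  by rewrite -Mp //; exact: (subsetP cycp).
- by apply/cyc_eq0P=> e; rewrite M => eM; rewrite M0 // acyc; case/setDP: eM.
- by apply/subsetP=> e eM; rewrite Mp // cycp; case/setDP: eM.
Qed.

Lemma cyclic_bipolar_minorP A B p : B \subset A -> A \subset edges G ->
  cyclic_bipolar (minor G A B) p
  <-> [/\ p \in A :\: B, cyc G A B = A & cyc G (A :\ p) B = B].
Proof.
move=> sBA sAG; have M : edges (minor G A B) = A :\: B.
  by rewrite edges_minor; apply/setIidPr/(subset_trans _ sAG)/subsetDl.
have M0 e : e \in A :\: B ->
    (e \in cyc (minor G A B) setT set0) = (e \in cyc G A B).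
  move=> eM; rewrite cyc_minor ?M //.
  by rewrite setIT setI0 set0U (setUidPl sBA).
have sBAp : p \notin B -> B \subset A :\ p by move=> pB; rewrite subsetD1 sBA.
have Mp e : p \notin B -> e \in A :\: B ->
    (e \in cyc (minor G A B) [set~ p] set0) = (e \in cyc G (A :\ p) B).
  move=> pB eM; rewrite cyc_minor ?M //.
  by rewrite setI0 set0U -setDE (setUidPl (sBAp pB)).
apply: iff_trans (cyclic_bipolarP _ _) _; rewrite M.
split=> [[pM allC /cyc_eq0P acyc]|[pM allC acyc]]; have /setDP[pA pB] := pM;
  split=> //.
- apply/eqP; rewrite eqEsubset cyc_sub //=; apply/subsetP=> e eA.
  have [eB|eB] := boolP (e \in B); first by rewrite (subsetP (cyc_sup _ _ _)).
  have eM : e \in A :\: B by rewrite inE eB.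
  by rewrite -M0 //; exact: (subsetP allC).
- apply/eqP; rewrite eqEsubset cyc_sup andbT; apply/subsetP=> e ce.
  apply/negPn/negP => eB; have eM : e \in A :\: B.
    by have /setD1P[_ eA] := subsetP (cyc_sub _ (sBAp pB)) e ce; rewrite inE eB.
  by have := acyc e; rewrite M Mp // ce => /(_ eM).
- by apply/subsetP=> e eM; rewrite M0 // allC; case/setDP: eM.
- by apply/cyc_eq0P=> e; rewrite M => eM; rewrite Mp // acyc; case/setDP: eM.
Qed.

(** Between closed sets, a bipolar minor is one step of the closure operator
    [cyc G (edges G)]: deleting the complement of the closed set [A] does not
    change the directed cycles inside [A]. *)
Lemma bipolar_minor_closedP A B p : B \subset A -> A \subset edges G ->
  cyc G (edges G) A = A ->
  bipolar (minor G A B) p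
  <-> [/\ p \in A :\: B, cyc G (edges G) B = B & cyc G (edges G) (p |: B) = A].
Proof.
move=> sBA sAG clA; apply: iff_trans (bipolar_minorP _ sBA sAG) _.
suff cl_eq D : D \subset A -> cyc G A D = cyc G (edges G) D.
  have cl_p : p \in A :\: B -> cyc G A (p |: B) = cyc G (edges G) (p |: B).
    by case/setDP=> pA _; rewrite cl_eq // subUset sub1set pA.
  split=> -[pM clB clp]; split=> //.
  - by rewrite -cl_eq.
  - by rewrite -cl_p.
  - by rewrite cl_eq.
  - by rewrite cl_p.
move=> sDA; apply/eqP; rewrite eqEsubset cyc_mono //=.
have sDG := subset_trans sDA sAG.
by rewrite -(cyc_restrict G sDG) cyc_mono // -clA cyc_mono.
Qed.

(** The dual statement, for unions of directed cycles: contracting [B], which is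
    such a union, does not change which edges outside [B] are on directed
    cycles. *)
Lemma cyclic_bipolar_minor_openP A B p : B \subset A -> A \subset edges G ->
  cyc G B set0 = B ->
  cyclic_bipolar (minor G A B) p
  <-> [/\ p \in A :\: B, cyc G A set0 = A & cyc G (A :\ p) set0 = B].
Proof.
move=> sBA sAG intB; apply: iff_trans (cyclic_bipolar_minorP _ sBA sAG) _.
suff int_eq D : B \subset D -> cyc G D B = cyc G D set0.
  have int_p : p \in A :\: B -> cyc G (A :\ p) B = cyc G (A :\ p) set0.
    by case/setDP=> _ pB; rewrite int_eq // subsetD1 sBA.
  split=> -[pM intA intp]; split=> //.
  - by rewrite -int_eq.
  - by rewrite -int_p.
  - by rewrite int_eq.
  - by rewrite int_p.
move=> sBD; apply/eqP; rewrite eqEsubset andbC cyc_mono ?sub0set //=.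
by rewrite -(cyc_contract G D set0) cyc_mono // -{1}intB cyc_mono.
Qed.

End BipolarMinors.

(** * Bipolar digraphs are 2-connected *)

Section TwoConnected.
Context {T : finType} (G : digraph T).
Implicit Types (A B C D : {set T}) (e f p : T) (u v : vtype G).

(** Let every vertex [v] lie on a directed path from [s] to [t] in an acyclic part
    of [G]. A removed vertex [w] cannot be both on the part before [v] and on
    the part after [v], so [v] stays connected to [s] or to [t]; and the edge
    [p] joins [s] to [t]. The orientation of [p] is left open to cover both
    bipolar and cyclic-bipolar digraphs. *)
Lemma st_acyclic_two_connected A s t p :
  p \in edges G ->
  (src G p = s /\ tgt G p = t) \/ (src G p = t /\ tgt G p = s) ->
  cyc G A set0 = set0 -> s != t ->
  {in vertices G, forall v, reach G A set0 s v /\ reach G A set0 v t} ->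
  two_connected G.
Proof.
move=> pG pst acyc st s_v_t; set r := step G A set0 in s_v_t *.
have antisym u v : connect r u v -> connect r v u -> u = v.
  move=> uv vu; apply/eqP/negPn/negP => nuv.
  case/connectP: uv vu nuv => -[|w q] /=; first by move=> _ ->; rewrite eqxx.
  case/andP=> ruw wq -> vu _; case/negP: (acyclic_step acyc ruw).
  by apply: connect_trans vu; apply/connectP; exists q.
have toAdj B u v : connect (adj G B) u v = reach G B B u v.
  by apply: eq_connect; apply: adj_step.
have sym B : connect_sym (adj G B).
  by move=> u v; rewrite !toAdj reach_sym.
split.
- apply/card_gt1P; exists s, t; split=> //; apply/vertexP; exists p => //;
  by case: pst => -[-> ->]; auto.
- move=> u v uV vV; have [_ ut] := s_v_t u uV; have [_ vt] := s_v_t v vV.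
  have sub x y : connect r x y -> connect (adj G (edges G)) x y.
    rewrite toAdj; apply: reach_sub => e eG; last by rewrite inE.
    by move=> _; apply: reach_fwd.
  by rewrite (connect_trans (sub _ _ ut)) // sym sub.
move=> w wV x y /setD1P[xw xV] /setD1P[yw yV].
set q := adj G _.
have qsym := sym (edges G :\: incident G w); rewrite -/q in qsym.
have sub a b :
    connect (fun u v => [&& r u v, u != w & v != w]) a b -> connect q a b.
  apply: connect_sub => {}a {}b /and3P[/stepP[e eG ev] aw bw].
  apply: connect1; rewrite /q adj_step; apply/stepP; exists e => //; left.
  case: ev => -[]; last by rewrite inE.
  by move=> eA ea eb; rewrite !inE eG ea eb negb_or aw bw.
have to_st z : z \in vertices G -> z != w ->
   (s != w) && connect q z s || (t != w) && connect q z t.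
  move=> zV zw; have [sz zt] := s_v_t z zV.
  have [sz'|/andP[_ wz]] := orP (connect_avoid w sz).
    have [sw|/= sw] := eqVneq s w; last by rewrite qsym (sub _ _ sz').
    have [szeq|[? /and3P[_]]] := connect_first sz'; last by rewrite sw eqxx.
    by rewrite -szeq sw eqxx in zw.
  have [zt'|/andP[zw' _]] := orP (connect_avoid w zt); last first.
    by rewrite (antisym _ _ zw' wz) eqxx in zw.
  have [tw|/= tw] := eqVneq t w; last by rewrite (sub _ _ zt') orbT.
  have [zteq|[? /and3P[_]]] := connect_last zt'; last by rewrite tw eqxx.
  by rewrite zteq tw eqxx in zw.
have q_st : s != w -> t != w -> connect q s t.
  move=> sw tw; apply: connect1; rewrite /q adj_step; apply/stepP.
  exists p => //; have -> : p \in edges G :\: incident G w.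
    by rewrite !inE pG; case: pst => -[-> ->]; rewrite negb_or sw tw.
  by case: pst => -[-> ->]; [left|right].
have [/andP[sw xs]|/andP[tw xt]] := orP (to_st x xV xw);
have [/andP[sw' ys]|/andP[tw' yt]] := orP (to_st y yV yw).
- by rewrite (connect_trans xs) // qsym.
- by rewrite (connect_trans xs) // (connect_trans (q_st _ _)) // qsym.
- by rewrite (connect_trans xt) // qsym (connect_trans ys) // q_st.
- by rewrite (connect_trans xt) // qsym.
Qed.

Lemma reach_pivot p x y : p \in edges G ->
  reach G setT set0 x y ->
  reach G [set~ p] set0 x y
  || (reach G [set~ p] set0 x (src G p)
      && reach G [set~ p] set0 (tgt G p) y).
Proof.
move=> pG cxy; apply: connect_add_arc; move: cxy.
apply: connect_sub => u v /stepP[e eG [[_ <- <-]|[]]]; last by rewrite inE.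
apply: connect1; have [->|ep] := eqVneq e p; first by rewrite !eqxx orbT.
by apply/orP; left; apply/stepP; exists e => //; left; rewrite !inE.
Qed.

Lemma edges1_or p : p \in edges G ->
  edges G = [set p] \/ exists2 e, e \in edges G & e != p.
Proof.
move=> pG; have [|/subsetPn[e eG]] := boolP (edges G \subset [set p]).
  by rewrite subset1 => /predU1P[|/eqP G0]; [left | rewrite G0 inE in pG].
by rewrite inE; right; exists e.
Qed.

Lemma bipolar_block p :
  bipolar G p ->
  [/\ loopless G, two_connected G & 1 < #|edges G|] \/ single_isthmus G.
Proof.
move=> /bipolarP[pG cyc0 cycp].
have no_loop : loopless G.
  move=> e eG; apply/eqP => se; move/setP/(_ e): cyc0.
  by rewrite !inE eG se connect0.
have [G1|[e eG ep]] := edges1_or pG.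
  by right; exists p; last exact: no_loop.
left; split=> //; last by apply/card_gt1P; exists e, p.
apply: (st_acyclic_two_connected (A := setT) (p := p)) (no_loop p pG) _; auto.
have pT : reach G setT set0 (src G p) (tgt G p) by apply: reach_fwd.
move=> v /vertexP[f fG vf].
have [|sf ft] := bipolar_paths pG fG (subsetP cycp f fG).
  by rewrite cyc0 inE.
have fT : reach G setT set0 (src G f) (tgt G f) by apply: reach_fwd.
by case: vf => <-; split=> //;
   [exact: connect_trans ft | exact: connect_trans fT].
Qed.

(** Here the poles are the ends of [p] in the opposite roles, and the acyclic part
    is [G] without [p]. *)
Lemma cyclic_bipolar_block p :
  cyclic_bipolar G p ->
  [/\ loopless G, two_connected G & 1 < #|edges G|] \/ single_loop G.
Proof.
move=> /cyclic_bipolarP[pG allC cyc0].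
pose r := step G [set~ p] set0.
have reachT f : f \in edges G -> reach G setT set0 (tgt G f) (src G f).
  by move/(subsetP allC); rewrite !inE => /andP[].
have no_back f : f \in edges G -> f != p -> ~~ connect r (tgt G f) (src G f).
  move=> fG fp; apply/negP => tf; move/setP/(_ f): cyc0.
  by rewrite !inE fG fp tf.
have st : connect r (tgt G p) (src G p).
  by have /(reach_pivot pG)/orP[|/andP[]] := reachT p pG.
have paths f : f \in edges G -> f != p ->
    connect r (tgt G p) (src G f) /\ connect r (tgt G f) (src G p).
  move=> fG fp; have /(reach_pivot pG)/orP[|/andP[? ?]//] := reachT f fG.
  by move=> tf; case/negP: (no_back f fG fp).
have [G1|[e eG ep]] := edges1_or pG.
  right; exists p => //; have [->//|[z /stepP[f]]] := connect_first st.
  by rewrite G1 => /set1P-> [[]|[]]; rewrite !inE ?eqxx.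
have st_neq : tgt G p != src G p.
  have [se te] := paths e eG ep; apply/eqP => tp; case/negP: (no_back e eG ep).
  by apply: connect_trans te _; rewrite -tp.
left; split; last by apply/card_gt1P; exists e, p.
  move=> f fG; have [->|fp] := eqVneq f p; first by rewrite eq_sym.
  by apply: contra (no_back f fG fp) => /eqP->; exact: connect0.
apply: (st_acyclic_two_connected (p := p)) cyc0 st_neq _; auto.
move=> v /vertexP[f fG vf]; have [fp|fp] := eqVneq f p.
  by case: vf => <-; rewrite fp; split=> //; exact: connect0.
have [sf ft] := paths f fG fp.
have fr : connect r (src G f) (tgt G f) by apply: reach_fwd; rewrite // !inE.
by case: vf => <-; split=> //;
   [exact: connect_trans ft | exact: connect_trans fr].
Qed.

End TwoConnected.

(** * Minima, choice and sorted sequences *)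

Lemma seq_choice (X : Type) n (P : nat -> X -> Prop) :
  (forall k, k < n -> exists x, P k x) ->
  exists2 xs, size xs = n & forall k x0, k < n -> P k (nth x0 xs k).
Proof.
elim: n => [|n IHn] exP; first by exists [::].
have [k kn|xs xsn xsP] := IHn; first by apply: exP; apply: ltnW.
have [x xP] := exP n (leqnn _).
exists (rcons xs x) => [|k x0]; first by rewrite size_rcons xsn.
rewrite ltnS nth_rcons xsn; have [kn _|//|-> _ //] := ltngtP k n.
exact: xsP.
Qed.

Section Minima.
Context {disp : Order.disp_t} {T : finOrderType disp}.
Implicit Types (A : {set T}) (e m x : T).

Lemma is_min_exists A : A != set0 -> exists m, is_min A m.
Proof.
case/set0Pn=> e eA; case: (arg_minP id eA) => m mA mP.
by exists m; apply/andP; split=> //; apply/forall_inP.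
Qed.

Lemma is_min_le A m e : is_min A m -> e \in A -> (m <= e)%O.
Proof. by case/andP=> _ /forall_inP; apply. Qed.

Lemma is_min_in A m : is_min A m -> m \in A.
Proof. by case/andP. Qed.

Lemma mem_take_lt_sorted (xs : seq T) x0 k x :
  sorted <%O xs -> k < size xs ->
  (x \in take k xs) = (x \in xs) && (x < nth x0 xs k)%O.
Proof.
move=> sxs kn; move: (sxs); rewrite lt_sorted_pairwise -{1}(cat_take_drop k xs).
have -> : (x \in xs) = (x \in take k xs ++ drop k xs) by rewrite cat_take_drop.
rewrite mem_cat (drop_nth x0 kn) pairwise_cat /= inE.
case/and4P=> /allrelP lt_take _ /allP lt_drop _.
have [xk|xk] := boolP (x \in take k xs); first by rewrite lt_take ?mem_head.
case: eqVneq => [->|_] /=; first by rewrite ltxx.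
by have [/lt_drop/lt_gtF-> | //] := boolP (x \in drop k.+1 xs).
Qed.

End Minima.

(** * The greedy chain of a closure operator *)

Section Greedy.
Context {disp : Order.disp_t} {T : finOrderType disp}.
Implicit Types (A B S : {set T}) (s : seq {set T}) (a e p q : T).

Variables (cl : {set T} -> {set T}) (E : {set T}).
Hypothesis cl_ext : forall A, A \subset cl A.
Hypothesis cl_mono : forall A B, A \subset B -> cl A \subset cl B.
Hypothesis cl_idem : forall A, cl (cl A) = cl A.
Hypothesis clE : cl E = E.

Definition below a := [set e in E | (e < a)%O].
(** The elements kept by the greedy algorithm that scans [E] in increasing order
    and discards what is spanned by the smaller elements. *)
Definition greedy_basis := [set a in E | a \notin cl (below a)].
Definition greedy_chain :=
  rcons [seq cl (below a) | a <- Order.enum greedy_basis] E.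

(** The common form of the two halves of a filtration with bipolar and
    cyclic-bipolar minors, for two dual closure operators. *)
Record closure_chain s : Prop := ClosureChain {
  chain_nonempty : s != [::];
  chain_first : nth set0 s 0 = cl set0;
  chain_last : nth set0 s (size s).-1 = E;
  chain_step : forall k, 1 <= k <= (size s).-1 ->
    exists2 p, is_min (nth set0 s k :\: nth set0 s k.-1) p &
               cl (p |: nth set0 s k.-1) = nth set0 s k;
  chain_min : forall j k p q, 1 <= j -> j < k -> k <= (size s).-1 ->
    is_min (nth set0 s j :\: nth set0 s j.-1) p ->
    is_min (nth set0 s k :\: nth set0 s k.-1) q -> (p < q)%O
}.

Lemma cl_min A B : A \subset cl B -> cl A \subset cl B.
Proof. by move/cl_mono; rewrite cl_idem. Qed.

Lemma cl_setU1 a A : cl (a |: cl A) = cl (a |: A).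
Proof.
apply/eqP; rewrite eqEsubset cl_min ?cl_mono ?setUS //.
rewrite subUset cl_mono ?subsetUr // andbT sub1set.
by rewrite (subsetP (cl_ext _)) // setU11.
Qed.

(** The least element of [S] outside the closure of its greedy elements would be
    spanned by smaller elements of [S], which are all in that closure. *)
Lemma cl_greedy S : S \subset E -> {in S, forall e, below e \subset S} ->
  cl S = cl (S :&: greedy_basis).
Proof.
move=> SE Sdown; apply/eqP; rewrite eqEsubset andbC cl_mono ?subsetIl //=.
apply: cl_min; rewrite -setD_eq0; apply/negPn/negP => /is_min_exists[e emin].
have /setDP[eS /negP[]] := is_min_in emin.
have [eB|] := boolP (e \in greedy_basis).
  by apply: (subsetP (cl_ext _)); rewrite inE eS.
rewrite inE (subsetP SE) //= negbK; apply: subsetP; apply: cl_min.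
apply/subsetP=> f fe; apply/negPn/negP=> fS.
have := is_min_le (e := f) emin; rewrite inE fS (subsetP (Sdown e eS)) // leNgt.
by move: fe; rewrite inE => /andP[_ ->] /(_ isT).
Qed.

Lemma below_sub a : below a \subset E.
Proof. by apply/subsetP=> e; rewrite inE => /andP[]. Qed.

Lemma below_trans a e : e \in below a -> below e \subset below a.
Proof.
rewrite inE => /andP[_ ea]; apply/subsetP=> f.
by rewrite !inE => /andP[-> /lt_trans->].
Qed.

Lemma mem_greedy_seq a : (a \in Order.enum greedy_basis) = (a \in greedy_basis).
Proof. by rewrite mem_sort mem_enum. Qed.

Lemma greedy_seq_sorted : sorted <%O (Order.enum greedy_basis).
Proof. by rewrite lt_sorted_uniq_le sort_uniq enum_uniq sort_le_sorted. Qed.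

(** Every term of the greedy chain is spanned by an initial segment of the basis;
    the uniform description covers the last term [E]. *)
Lemma nth_greedy_chain k : k <= size (Order.enum greedy_basis) ->
  nth set0 greedy_chain k = cl [set x in take k (Order.enum greedy_basis)].
Proof.
set xs := Order.enum _; rewrite leq_eqVlt => /predU1P[->|kn].
  rewrite nth_rcons size_map ltnn eqxx take_size -[LHS]clE cl_greedy //.
    congr cl; apply/setP=> e; rewrite !inE mem_greedy_seq !inE.
    by case: (e \in E).
  by move=> e _; apply: below_sub.
case Exs: xs kn => [//|x0 xs']; rewrite -Exs => kn.
rewrite nth_rcons size_map kn (nth_map x0) //.
rewrite cl_greedy ?below_sub //; last exact: below_trans.
congr cl; apply/setP=> e.
rewrite !inE (mem_take_lt_sorted x0) ?greedy_seq_sorted //.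
by rewrite mem_greedy_seq !inE; case: (e \in E) => //=; rewrite andbC.
Qed.

Lemma greedy_chainP : closure_chain greedy_chain.
Proof.
set xs := Order.enum greedy_basis.
have size_chain : (size greedy_chain).-1 = size xs.
  by rewrite size_rcons size_map.
have step k x0 : k < size xs ->
    is_min (nth set0 greedy_chain k.+1 :\: nth set0 greedy_chain k)
           (nth x0 xs k)
    /\ cl (nth x0 xs k |: nth set0 greedy_chain k) = nth set0 greedy_chain k.+1.
  move=> kn; set a := nth x0 xs k.
  have clF : cl (a |: nth set0 greedy_chain k) = nth set0 greedy_chain k.+1.
    rewrite !nth_greedy_chain // 1?ltnW // cl_setU1; congr cl; apply/setP=> e.
    by rewrite !inE (take_nth x0 kn) mem_rcons inE.
  have Fk : nth set0 greedy_chain k = cl (below a).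
    by rewrite nth_rcons size_map kn (nth_map x0).
  have : a \in greedy_basis by rewrite -mem_greedy_seq mem_nth.
  rewrite inE => /andP[aE a_cl]; split=> //; apply/andP; split.
    by rewrite inE Fk a_cl -clF (subsetP (cl_ext _)) // setU11.
  apply/forall_inP=> e /setDP[eF eFk]; rewrite leNgt; apply: contra eFk => ea.
  rewrite Fk (subsetP (cl_ext _)) // inE ea andbT -clE.
  apply: subsetP eF; rewrite -clF cl_mono // subUset sub1set aE Fk -clE.
  by rewrite cl_mono // below_sub.
have is_min_nth j x0 p : 1 <= j <= size xs ->
    is_min (nth set0 greedy_chain j :\: nth set0 greedy_chain j.-1) p ->
    p = nth x0 xs j.-1.
  case: j => // j /= jn pmin; have [amin _] := step j x0 jn.
  apply/le_anti; rewrite (is_min_le pmin) ?(is_min_le amin) //;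
  exact: is_min_in.
split; rewrite ?size_chain.
- by rewrite -size_eq0 size_rcons.
- by rewrite nth_greedy_chain //; congr cl; apply/setP=> e; rewrite take0 !inE.
- by rewrite nth_rcons size_map ltnn eqxx.
- case=> // k /= kn; case Exs: xs (kn) => [//|x0 xs'] _.
  by have [] := step k x0 kn; exists (nth x0 xs k).
move=> j k p q j0 jk kn pmin qmin.
have jn : 1 <= j <= size xs by rewrite j0 (leq_trans (ltnW jk)).
have kn' : 1 <= k <= size xs by rewrite (leq_trans j0 (ltnW jk)).
rewrite (is_min_nth j p p jn pmin) (is_min_nth k p q kn' qmin).
move: j0 jk kn {pmin qmin jn kn'}.
case: j k => [|j] [|k] //= _ jk kn.
by apply: (sorted_ltn_nth lt_trans _ greedy_seq_sorted);
   rewrite ?inE // (ltn_trans _ kn).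
Qed.

Section Uniqueness.
Variable s : seq {set T}.
Hypothesis chain_s : closure_chain s.
Let n := (size s).-1.
Let F k := nth set0 s k.
Let D k := F k :\: F k.-1.

Lemma chain_closed k : k <= n -> cl (F k) = F k.
Proof.
case: k => [|k] kn; first by rewrite /F (chain_first chain_s) cl_idem.
by have [p _ clp] := chain_step chain_s (k := k.+1) kn; rewrite /F -clp cl_idem.
Qed.

Lemma chain_mono j k : j <= k <= n -> F j \subset F k.
Proof.
case/andP; elim: k => [|k IHk]; first by rewrite leqn0 => /eqP->.
rewrite leq_eqVlt => /predU1P[-> //|jk] kn.
apply: subset_trans (IHk jk (ltnW kn)) _.
have [p _ clp] := chain_step chain_s (k := k.+1) kn.
rewrite -[F k.+1]clp.
by apply: subset_trans (cl_ext _); apply: subsetUr.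
Qed.

Lemma chain_level k e : k <= n -> e \in E -> e \notin F k ->
  exists2 i, k < i <= n & e \in D i.
Proof.
move=> kn; rewrite -(chain_last chain_s) -/n => eFn eFk.
have ex_i : exists i, e \in F i by exists n.
case: (ex_minnP ex_i) => i ei imin; exists i.
  rewrite imin // andbT ltnNge; apply: contra eFk => ik.
  by apply: (subsetP (chain_mono _)) ei; rewrite ik.
rewrite inE ei andbT; apply/negP => /imin; case: i {imin} ei => [|i] ei.
  by case/negP: eFk; apply: (subsetP (chain_mono _)) ei.
by rewrite ltnn.
Qed.

(** Since the least new elements increase along the chain, the one of step [k] is
    below everything outside the [k]-th lower term. *)
Lemma chain_min_le k m e : 1 <= k <= n -> is_min (D k) m ->
  e \in E -> e \notin F k.-1 -> (m <= e)%O.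
Proof.
move=> /andP[k0 kn] mmin eE eF.
have [|i /andP[ki iN] ei] := chain_level _ eE eF.
  by apply: leq_trans kn; apply: leq_pred.
rewrite prednK // in ki; move: ki; rewrite leq_eqVlt => /predU1P[ki|ki].
  by apply: (is_min_le mmin); rewrite ki.
have [|p pmin _] := chain_step chain_s (k := i).
  by rewrite iN andbT (leq_trans k0 (ltnW ki)).
apply: le_trans (ltW (chain_min chain_s k0 ki iN mmin pmin)) _.
exact: is_min_le pmin ei.
Qed.

(** A term is spanned by the least new elements of the steps up to it. *)
Lemma chain_sub_below j a : j <= n ->
  (forall i m, 1 <= i <= j -> is_min (D i) m -> m \in below a) ->
  F j \subset cl (below a).
Proof.
elim: j => [_ _|j IHj jn sub].
  by rewrite /F (chain_first chain_s) cl_mono ?sub0set.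
have [p pmin pcl] := chain_step chain_s (k := j.+1) jn.
rewrite /F -pcl; apply: cl_min; rewrite subUset sub1set.
rewrite (subsetP (cl_ext _)) ?(sub j.+1) //= IHj // => [|i m /andP[i0 ij]].
  exact: ltnW.
by apply: sub; rewrite i0 ltnW.
Qed.

(** The terms of any closure chain are thus forced by their least new elements:
    everything below [m] is in the lower term by [chain_min_le], and the earlier
    least elements, which span that term, are below [m]. *)
Lemma chain_is_min_basis k m : 1 <= k <= n -> is_min (D k) m ->
  F k.-1 = cl (below m) /\ m \in greedy_basis.
Proof.
move=> kn mmin; have /andP[k0 kle] := kn.
have k1n : k.-1 <= n by apply: leq_trans kle; apply: leq_pred.
have mE : m \in E.
  rewrite -(chain_last chain_s); have /setDP[mF _] := is_min_in mmin.
  by apply: (subsetP (chain_mono _)) mF; rewrite kle leqnn.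
have Fk : F k.-1 = cl (below m).
  apply/eqP; rewrite eqEsubset; apply/andP; split.
    apply: chain_sub_below => // i p /andP[i0 ik] pmin.
    have ik' : i < k by rewrite -[k]prednK.
    have pm := chain_min chain_s i0 ik' kle pmin mmin.
    rewrite inE pm andbT -(chain_last chain_s).
    have /setDP[pF _] := is_min_in pmin.
    by apply: (subsetP (chain_mono _)) pF; rewrite leqnn (leq_trans (ltnW ik')).
  rewrite -(chain_closed k1n) cl_mono //; apply/subsetP=> e.
  rewrite inE => /andP[eE]; apply: contraLR => eF.
  by rewrite -leNgt (chain_min_le kn mmin).
split=> //; rewrite inE mE -Fk; by have /setDP[] := is_min_in mmin.
Qed.

(** A basis element [a] first appears at some step; were it not the least new
    element there, it would be spanned by the least new elements so far, all
    smaller than [a]. *)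
Lemma chain_basis_is_min a : a \in greedy_basis ->
  exists2 k, 1 <= k <= n & is_min (D k) a.
Proof.
rewrite inE => /andP[aE a_cl].
have aF0 : a \notin F 0.
  apply: contra a_cl; rewrite /F (chain_first chain_s).
  exact/subsetP/cl_mono/sub0set.
have [k kn aD] := chain_level (leq0n n) aE aF0; exists k => //.
have /andP[k0 kle] := kn; have [p pmin _] := chain_step chain_s kn.
have := is_min_le pmin aD; rewrite le_eqVlt => /predU1P[<- //|pa].
case/negP: a_cl; have /setDP[aF _] := aD.
apply: (subsetP (chain_sub_below kle _)) aF => i m /andP[i0 ik] mmin.
rewrite inE; apply/andP; split.
  rewrite -(chain_last chain_s); have /setDP[mF _] := is_min_in mmin.
  by apply: (subsetP (chain_mono _)) mF; rewrite leqnn (leq_trans ik).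
move: ik; rewrite leq_eqVlt => /predU1P[ik|ik].
  rewrite ik in mmin; apply: le_lt_trans pa; apply: is_min_le mmin _.
  exact: is_min_in.
by apply: lt_trans pa; apply: chain_min ik kle mmin pmin.
Qed.

Lemma closure_chain_unique : s = greedy_chain.
Proof.
have size_s : size s = n.+1.
  by rewrite prednK // lt0n size_eq0 (chain_nonempty chain_s).
have [k kn|ps ps_n psP] := @seq_choice T n (fun k m => is_min (D k.+1) m).
  by have [p pmin _] := chain_step chain_s (k := k.+1) kn; exists p.
suff ps_basis : ps = Order.enum greedy_basis.
  apply: (@eq_from_nth _ set0).
    by rewrite size_rcons size_map -ps_basis ps_n size_s.
  move=> k; rewrite size_s ltnS nth_rcons size_map -ps_basis ps_n.
  have [kn _|//|-> _] := ltngtP k n; last exact: chain_last.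
  case Eps: ps => [|x0 ps']; first by rewrite -ps_n Eps in kn.
  rewrite -Eps (nth_map x0) ?ps_n //.
  by have [Fk _] := @chain_is_min_basis k.+1 _ kn (psP k x0 kn); exact: Fk.
apply: lt_sorted_eq.
- case: ps ps_n psP => // x0 ps' ps_n psP; apply/(sortedP x0) => i.
  rewrite ps_n => iN; apply: (chain_min chain_s (j := i.+1) (k := i.+2)) => //.
    exact: (psP i x0 (ltnW iN)).
  exact: (psP i.+1 x0 iN).
- exact: greedy_seq_sorted.
move=> a; rewrite mem_greedy_seq; apply/idP/idP => [aps|].
  have an : index a ps < n by rewrite -ps_n index_mem.
  have := psP _ a an; rewrite nth_index // => amin.
  by have [] := @chain_is_min_basis (index a ps).+1 a an amin.
case/chain_basis_is_min=> -[//|k] /= kn amin.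
have bmin := psP k a kn.
suff -> : a = nth a ps k by rewrite mem_nth ?ps_n.
by apply/le_anti; rewrite (is_min_le amin) ?(is_min_le bmin) //;
   exact: is_min_in.
Qed.

End Uniqueness.
End Greedy.

(** * The active filtration *)

Section ActiveFiltration.
Context {disp : Order.disp_t} {T : finOrderType disp} (G : digraph T).
Implicit Types (A B C D : {set T}) (a e p q : T) (Phi : @set_chain disp T).

Local Notation E := (edges G).

(** Directed-cycle closure: for [A] inside [E], the complement in [E] of the union
    of the directed cocycles disjoint from [A]. *)
Definition dicl A := cyc G E A.

Lemma dicl_sup A : A \subset dicl A. Proof. exact: cyc_sup. Qed.
Lemma dicl_mono A B : A \subset B -> dicl A \subset dicl B.
Proof. exact: cyc_mono. Qed.
Lemma dicl_idem A : dicl (dicl A) = dicl A. Proof. exact: cyc_contract. Qed.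
Lemma dicl_edges : dicl E = E.
Proof. by apply/eqP; rewrite eqEsubset cyc_sub ?cyc_sup. Qed.

(** Directed-cocycle closure, the dual of [dicl]: the complement of the union of
    the directed cycles disjoint from [A]. Labels that are not edges belong to
    every closed set, so that the ground set is [setT]. *)
Definition cocl A := ~: cyc G (~: A) set0.

Lemma cocl_sup A : A \subset cocl A.
Proof. by rewrite subsetC cyc_sub ?sub0set. Qed.
Lemma cocl_mono A B : A \subset B -> cocl A \subset cocl B.
Proof. by move=> sAB; rewrite setCS cyc_mono // setCS. Qed.
Lemma cocl_idem A : cocl (cocl A) = cocl A.
Proof. by rewrite /cocl setCK cyc_restrict ?sub0set. Qed.
Lemma cocl_setT : cocl setT = setT.
Proof. by apply/eqP; rewrite -subTset cocl_sup. Qed.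

Lemma min_geP A a e : e \in A ->
  min_ge A a = [forall f in A, (a <= f)%O].
Proof.
move=> eA; apply/existsP/forall_inP => [[m /andP[mmin am]] f fA|leA].
  exact: le_trans am (is_min_le mmin fA).
have [|m mmin] := @is_min_exists _ _ A; first by apply/set0Pn; exists e.
by exists m; rewrite mmin leA //; exact: is_min_in.
Qed.

Lemma directed_cocycle_sub D : directed_cocycle G D -> D \subset E.
Proof.
case/andP=> _ /existsP[X /andP[/eqP-> _]].
by apply/subsetP=> e; rewrite inE => /andP[].
Qed.

Lemma disjoint_below D a : D \subset E ->
  [disjoint D & below E a] = [forall f in D, (a <= f)%O].
Proof.
move=> DE; apply/idP/forall_inP => [dis f fD|leD].
  have := disjointFr dis fD; rewrite inE (subsetP DE) //= => /negbT.
  by rewrite -leNgt.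
apply/pred0P=> f /=; apply/negP => /andP[/leD af].
by rewrite inE ltNge af andbF.
Qed.

Lemma sub_setC_below C a :
  (C \subset ~: below setT a) = [forall f in C, (a <= f)%O].
Proof.
apply/subsetP/forall_inP => leC f /leC; first by rewrite !inE -leNgt.
by rewrite !inE -leNgt.
Qed.

Lemma dual_active_basis : dual_active G = greedy_basis dicl E.
Proof.
apply/setP=> a; rewrite [RHS]in_set andbC -in_setD in_set.
apply/existsP/in_directed_cocycle => -[D].
  case/andP=> dD /andP[aD leD]; exists D; rewrite // aD.
  by rewrite disjoint_below ?directed_cocycle_sub.
move=> dD /andP[aD]; rewrite disjoint_below ?directed_cocycle_sub // => leD.
by exists D; rewrite dD /is_min aD.
Qed.

Lemma active_basis : active G = greedy_basis cocl setT.
Proof.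
apply/setP=> a; rewrite [RHS]in_set in_setT /cocl in_setC negbK in_set.
apply/existsP/in_directed_cycle => -[C].
  by case/andP=> dC /andP[aC leC]; exists C; rewrite // aC sub_setC_below.
move=> dC /andP[aC]; rewrite sub_setC_below => leC.
by exists C; rewrite dC /is_min aC.
Qed.

(** The directed cocycles with minimum at least [a] are those that avoid
    [below E a]. *)
Lemma up_active : up (active_filtration G) = greedy_chain dicl E.
Proof.
rewrite /= /greedy_chain dual_active_basis; congr rcons; apply: eq_map => a.
apply/setP=> e; apply/idP/idP => [/setDP[eE eD]|ea].
  apply/negPn/negP=> ea.
  have /in_directed_cocycle[D dD /andP[De disD]] : e \in E :\: dicl (below E a).
    by rewrite inE ea.
  case/negP: eD; apply/bigcupP; exists D => //; rewrite dD (min_geP _ De).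
  by rewrite -disjoint_below ?directed_cocycle_sub.
have eE : e \in E by apply: (subsetP (cyc_sub _ _)) ea; apply: below_sub.
rewrite inE eE andbT; apply/negP=> /bigcupP[D /andP[dD]] minD De.
suff : e \in E :\: dicl (below E a) by rewrite inE ea.
apply/in_directed_cocycle; exists D; rewrite // De.
by rewrite disjoint_below ?directed_cocycle_sub // -(min_geP _ De).
Qed.

Lemma down_active :
  down (active_filtration G) = [seq ~: A | A <- greedy_chain cocl setT].
Proof.
rewrite /= /greedy_chain active_basis map_rcons setCT -map_comp; congr rcons.
apply: eq_map => a /=; rewrite setCK.
apply/setP=> e; apply/bigcupP/in_directed_cycle => -[C].
  case/andP=> dC minC Ce; exists C; rewrite // Ce.
  by rewrite sub_setC_below -(min_geP _ Ce).
move=> dC /andP[Ce]; rewrite sub_setC_below -(min_geP _ Ce) => minC.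
by exists C; rewrite ?dC.
Qed.

Lemma cyc_setT : cyc G setT set0 = dicl set0.
Proof.
apply/setP=> e.
apply/in_directed_cycle/in_directed_cycle => -[C dC /andP[eC _]].
  by exists C; rewrite // eC; case/and3P: dC.
by exists C; rewrite // eC subsetT.
Qed.

Lemma mid_active : mid (active_filtration G) = dicl set0.
Proof.
apply/setP=> e; apply/bigcupP/in_directed_cycle => -[C dC eC]; exists C => //.
  by rewrite eC; case/and3P: dC.
by case/andP: eC.
Qed.

Lemma cyc_sub_edges A : cyc G A set0 \subset E.
Proof.
apply: subset_trans (cyc_mono G (subsetT A) (subxx set0)) _.
by rewrite cyc_setT cyc_sub ?sub0set.
Qed.

Lemma coclE A p : cocl (p |: ~: A) = ~: cyc G (A :\ p) set0.
Proof. by rewrite /cocl setCU setCK setIC -setDE. Qed.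

Lemma setDCC A B : ~: A :\: ~: B = B :\: A.
Proof. by rewrite setDE setCK setIC -setDE. Qed.

Lemma nth_setC (s : seq {set T}) k : k <= (size s).-1 -> s != [::] ->
  nth set0 [seq ~: A | A <- s] k = ~: nth set0 s k.
Proof.
move=> ks s0; rewrite (nth_map set0) //.
by rewrite -[size s]prednK // lt0n size_eq0.
Qed.

Lemma descending_ind n (P : nat -> Prop) :
  P n -> (forall k, k < n -> P k.+1 -> P k) -> forall k, k <= n -> P k.
Proof.
move=> Pn Pstep k /subnKC; move: (n - k) => j; elim: j k => [|j IHj] k.
  by rewrite addn0 => ->.
move=> kj; apply: Pstep; first by rewrite -kj addnS ltnS leq_addr.
by apply: IHj; rewrite addSnnS.
Qed.

(** The top term [E] is closed, and [bipolar_minor_closedP] carries closedness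
    down the chain; dually from [set0] along the decreasing part. The two parts
    meet in a set that is closed, hence contains all directed cycles, and is a
    union of directed cycles. *)
Lemma filtration_chains Phi : filtration G Phi -> bipolar_minors G Phi ->
  [/\ closure_chain dicl E (up Phi), mid Phi = dicl set0
    & closure_chain cocl setT [seq ~: A | A <- down Phi]].
Proof.
move=> fP [upP downP]; have up0 := up_nonempty _ _ fP.
have down0 := down_nonempty _ _ fP.
have up_sub k : k <= len_up Phi -> Fup Phi k \subset E.
  move: k; apply: descending_ind => [|k kn sE].
    by rewrite (up_last _ _ fP).
  exact: subset_trans (proper_sub (up_proper _ _ fP k.+1 kn)) sE.
have down_sub k : k <= len_down Phi -> Fdown Phi k \subset E.
  elim: k => [_|k IHk kn].
    by rewrite (down_first _ _ fP) -(up_first _ _ fP) up_sub.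
  apply: subset_trans (IHk (ltnW kn)).
  exact: proper_sub (down_proper _ _ fP k.+1 kn).
have dicl_step k : k < len_up Phi -> dicl (Fup Phi k.+1) = Fup Phi k.+1 ->
    exists2 p, is_min (Fup Phi k.+1 :\: Fup Phi k) p
      & dicl (Fup Phi k) = Fup Phi k /\ dicl (p |: Fup Phi k) = Fup Phi k.+1.
  move=> kn fl; have [p pmin pbip] := upP k.+1 kn; exists p => //.
  have sk := proper_sub (up_proper _ _ fP k.+1 kn).
  by have [_ ? ?] := (bipolar_minor_closedP p sk (up_sub _ kn) fl).1 pbip.
have diclF k : k <= len_up Phi -> dicl (Fup Phi k) = Fup Phi k.
  move: k; apply: descending_ind => [|k kn fl].
    by rewrite (up_last _ _ fP) dicl_edges.
  by have [p _ []] := dicl_step k kn fl.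
have int_step k : k < len_down Phi ->
    cyc G (Fdown Phi k.+1) set0 = Fdown Phi k.+1 ->
    exists2 p, is_min (Fdown Phi k :\: Fdown Phi k.+1) p
      & cyc G (Fdown Phi k) set0 = Fdown Phi k
        /\ cyc G (Fdown Phi k :\ p) set0 = Fdown Phi k.+1.
  move=> kn int; have [p pmin pbip] := downP k.+1 kn; exists p => //.
  have sk := proper_sub (down_proper _ _ fP k.+1 kn).
  have sE := down_sub _ (ltnW kn).
  by have [_ ? ?] := (cyclic_bipolar_minor_openP p sk sE int).1 pbip.
have intF k : k <= len_down Phi -> cyc G (Fdown Phi k) set0 = Fdown Phi k.
  move: k; apply: descending_ind => [|k kn int].
    by rewrite (down_last _ _ fP); apply/eqP; rewrite -subset0 cyc_sub.
  by have [p _ []] := int_step k kn int.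
have midE : mid Phi = dicl set0.
  apply/eqP; rewrite eqEsubset; apply/andP; split.
    rewrite -(down_first _ _ fP) -intF // -cyc_setT cyc_mono ?subsetT //.
  by rewrite -(up_first _ _ fP) -diclF // dicl_mono ?sub0set.
split=> //.
- split=> //.
  + by rewrite -midE -(up_first _ _ fP).
  + exact: up_last _ _ fP.
  + case=> // k kn; have [p pmin [_ ?]] := dicl_step k kn (diclF _ kn).
    by exists p.
  + by move=> j k p q j0 jk kn; apply: (up_min _ _ fP).
have nthC k : k <= len_down Phi ->
    nth set0 [seq ~: A | A <- down Phi] k = ~: Fdown Phi k.
  by move=> kn; rewrite nth_setC.
split; rewrite ?size_map.
- by rewrite -size_eq0 size_map size_eq0.
- by rewrite nthC // (down_first _ _ fP) midE /cocl setC0 cyc_setT.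
- by rewrite nthC // (down_last _ _ fP) setC0.
- case=> // k kn; have [p pmin [_ clp]] := int_step k kn (intF _ kn).
  exists p; rewrite !nthC ?(ltnW kn) //; first by rewrite setDCC.
  by rewrite coclE clp.
move=> j k p q j0 jk kn; have jn := ltnW (leq_trans jk kn).
rewrite !nthC ?setDCC // ?(leq_trans (leq_pred _)) //.
exact: (down_min _ _ fP).
Qed.

Lemma chains_filtration Phi :
  closure_chain dicl E (up Phi) -> mid Phi = dicl set0 ->
  closure_chain cocl setT [seq ~: A | A <- down Phi] ->
  filtration G Phi /\ bipolar_minors G Phi.
Proof.
move=> upP midE downP.
have up0 := chain_nonempty upP.
have down0 : down Phi != [::].
  by have := chain_nonempty downP; rewrite -size_eq0 size_map size_eq0.
have nthC k : k <= len_down Phi ->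
    nth set0 [seq ~: A | A <- down Phi] k = ~: Fdown Phi k.
  by move=> kn; rewrite nth_setC.
have up_sub k : k <= len_up Phi -> Fup Phi k \subset E.
  move=> kn; rewrite -(chain_last upP).
  by apply: (chain_mono dicl_sup upP); rewrite kn leqnn.
have diclF k : k <= len_up Phi -> dicl (Fup Phi k) = Fup Phi k.
  exact: (chain_closed dicl_idem upP).
have intF k : k <= len_down Phi -> cyc G (Fdown Phi k) set0 = Fdown Phi k.
  move=> kn; apply: setC_inj.
  have := @chain_closed _ _ _ _ cocl_idem _ downP k.
  by rewrite size_map nthC // => /(_ kn); rewrite /cocl setCK.
have down_step k : 1 <= k <= len_down Phi ->
    exists2 p, is_min (Fdown Phi k.-1 :\: Fdown Phi k) p
             & cyc G (Fdown Phi k.-1 :\ p) set0 = Fdown Phi k.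
  move=> kn; have := chain_step downP (k := k); rewrite size_map => /(_ kn).
  have /andP[k0 kle] := kn; have k1 := leq_trans (leq_pred k) kle.
  rewrite !nthC // => -[p]; rewrite setDCC coclE => pmin /setC_inj clp.
  by exists p.
have up_sub1 k : k.-1 <= k <= len_up Phi -> Fup Phi k.-1 \subset Fup Phi k.
  exact: (chain_mono dicl_sup upP).
have down_sub1 k : 1 <= k <= len_down Phi -> Fdown Phi k \subset Fdown Phi k.-1.
  case/down_step=> p _ <-.
  by rewrite (subset_trans (cyc_sub _ _)) ?sub0set ?subsetDl.
split; split=> //.
- by rewrite midE; exact: (chain_first upP).
- apply: setC_inj; rewrite -nthC // (chain_first downP) midE.
  by rewrite /cocl setC0 cyc_setT.
- exact: (chain_last upP).
- by apply: setC_inj; rewrite -nthC // setC0 -(chain_last downP) size_map.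
- move=> k kn; have [p /is_min_in/setDP[pk pk1] _] := chain_step upP kn.
  apply/properP; split; last by exists p.
  by apply: up_sub1; rewrite leq_pred; case/andP: kn.
- move=> k kn; have [p /is_min_in/setDP[pk pk1] _] := down_step k kn.
  by apply/properP; split; [exact: down_sub1 | exists p].
- by move=> j k p q j0 jk kn; apply: (chain_min upP).
- move=> j k p q j0 jk kn; have jn := ltnW (leq_trans jk kn).
  have := chain_min downP (p := p) (q := q) j0 jk.
  by rewrite size_map !nthC ?setDCC // ?(leq_trans (leq_pred _)) //; apply.
- move=> k kn; have [p pmin clp] := chain_step upP kn; exists p => //.
  have /andP[k0 kle] := kn; have k1 := leq_trans (leq_pred k) kle.
  apply/bipolar_minor_closedP; rewrite ?up_sub1 ?leq_pred ?up_sub //.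
    exact: diclF.
  split; [exact: is_min_in | exact: diclF | exact: clp].
- move=> k kn; have [p pmin clp] := down_step k kn; exists p => //.
  have /andP[k0 kle] := kn; have k1 := leq_trans (leq_pred k) kle.
  apply/cyclic_bipolar_minor_openP; rewrite ?down_sub1 ?intF //.
    by rewrite -intF // cyc_sub_edges.
  by split=> //; exact: is_min_in.
Qed.

End ActiveFiltration.

Theorem proposition3p10 (disp : Order.disp_t) (T : finOrderType disp)
    (G : digraph T) (Gconnected : connected_graph G) :
  [/\ connected_filtration G (active_filtration G),
      unique (fun Phi => filtration G Phi /\ bipolar_minors G Phi)
             (active_filtration G) &
      unique (fun Phi => connected_filtration G Phi /\ bipolar_minors G Phi)
             (active_filtration G)].
Proof.
have [active_fil active_bip] :
    filtration G (active_filtration G)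
    /\ bipolar_minors G (active_filtration G).
  apply: chains_filtration; rewrite ?mid_active ?up_active ?down_active //.
    exact: greedy_chainP (dicl_sup G) (@dicl_mono _ _ G) (dicl_idem G)
                         (dicl_edges G).
  rewrite -map_comp (eq_map (setCK (T := T))) map_id.
  exact: greedy_chainP (cocl_sup G) (@cocl_mono _ _ G) (cocl_idem G)
                       (cocl_setT G).
have active_con : connected_filtration G (active_filtration G).
  have [upP downP] := active_bip; split=> // k kn.
    by have [p _ /bipolar_block] := upP k kn.
  by have [p _ /cyclic_bipolar_block] := downP k kn.
have active_uniq Phi : filtration G Phi -> bipolar_minors G Phi ->
    active_filtration G = Phi.
  move=> fil bip.
  have [chain_up mid_Phi chain_down] := filtration_chains fil bip.
  have upE := closure_chain_unique (dicl_sup G) (@dicl_mono _ _ G)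
                                   (dicl_idem G) chain_up.
  have downE := closure_chain_unique (cocl_sup G) (@cocl_mono _ _ G)
                                     (cocl_idem G) chain_down.
  have := up_active G; have := down_active G; have := mid_active G.
  rewrite -upE -downE -mid_Phi -map_comp (eq_map (setCK (T := T))) map_id.
  move: Phi {fil bip chain_up mid_Phi chain_down upE downE} => [d' m' u'].
  by case: (active_filtration G) => d m u /= -> -> ->.
split=> //; split=> // Phi [].
  exact: active_uniq.
by case=> fil _ _; exact: active_uniq.
Qed.
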